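(* Let $k\ge1$ and let $W_k(q)=\sum_{d\ge0}q^d\dim\mathcal H_d$ be the Hilbert series of the ring $\mathbf R_{2^k}^{SL[2]^{\otimes k}}$ of polynomials in $\mathbb C[x_1,\dots,x_{2^k}]$ invariant under the action $T_AP(x)=P(xA)$ of all $A=A_1\otimes\cdots\otimes A_k$ with $A_i\in SL(2,\mathbb C)$, where $\mathcal H_d$ is the subspace of invariants homogeneous of degree $d$. Then $$W_k(q)=\frac{\prod_{i=1}^k(1-a_i^2)}{\prod_{S\subseteq\{1,\dots,k\}}\Big(1-q\prod_{i\in S}a_i\big/\prod_{j\notin S}a_j\Big)}\Bigg|_{a_1^0a_2^0\cdots a_k^0}.$$
   Context: The expression on the right is understood by expanding each factor $1/(1-qM)$ as a geometric series in $q$, so that the coefficient of each power of $q$ is a Laurent polynomial in $a_1,\dots,a_k$; the operator $|_{a_1^0\cdots a_k^0}$ takes the constant term in $a_1,\dots,a_k$ of each coefficient. The $k$-fold tensor product of matrices is defined iteratively via $A\otimes B=[a_{ij}B]$. *)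

(* Defs.v *)
From HB Require Import structures.
From mathcomp Require Import all_boot all_order all_algebra.
From mathcomp Require Import finmap.
From mathcomp Require Import boolp classical_sets reals.
From mathcomp Require Import complex mxtens.
From mathcomp Require Import mpoly.
From mathcomp Require Import -(notations) monalg.

Set Implicit Arguments.
Unset Strict Implicit.
Unset Printing Implicit Defensive.

Import GRing.Theory.
Local Open Scope ring_scope.

(* [{mpoly R[n]}] has no negative exponents and the ring structure of [malg]
   requires a monoid of exponents without nontrivial units, so the ring of
   Laurent polynomials is built here on the additive group of [malg]: finitely
   supported functions from exponent vectors in Z^n to R, with convolution. *)
Definition laurent (n : nat) (R : comNzRingType) : Type :=
  malg 'rV[int]_n R.

Section LaurentRing.
Variables (n : nat) (R : comNzRingType).
Local Notation L := (laurent n R).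
Implicit Types f g h : L.

HB.instance Definition _ := GRing.Zmodule.copy L (malg 'rV[int]_n R).

Definition lcoef (u : 'rV[int]_n) (f : L) : R := mcoeff u f.

Definition lmonom (u : 'rV[int]_n) (c : R) : L := mkmalgU u c.

Definition lmul f g : L :=
  \sum_(u <- msupp f) \sum_(v <- msupp g)
    lmonom (u + v) (lcoef u f * lcoef v g).

Lemma lcoef_sum I (r : seq I) (P : pred I) (F : I -> L) u :
  lcoef u (\sum_(i <- r | P i) F i) = \sum_(i <- r | P i) lcoef u (F i).
Proof. exact: (raddf_sum (@mcoeff 'rV[int]_n R u)). Qed.

Lemma lmonom0 u : lmonom u 0 = 0.
Proof. exact: monalgU0. Qed.

Lemma lmonomD u : {morph lmonom u : x y / x + y}.
Proof. exact: monalgUD. Qed.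

Lemma lcoef_monom u v c : lcoef v (lmonom u c) = c *+ (u == v).
Proof. exact: mcoeffU. Qed.

Lemma lmulw (d1 d2 : {fset 'rV[int]_n}) f g :
  fsubset (msupp f) d1 -> fsubset (msupp g) d2 ->
  lmul f g = \sum_(u <- d1) \sum_(v <- d2)
    lmonom (u + v) (lcoef u f * lcoef v g).
Proof.
move=> le1 le2; rewrite /lmul (big_fset_incl _ le1) /=.
  apply: eq_bigr => u _; apply/big_fset_incl => // v _ /mcoeff_outdom.
  by rewrite /lcoef => ->; rewrite mulr0 lmonom0.
move=> u _ /mcoeff_outdom fu.
by rewrite big1 // => v _; rewrite /lcoef fu mul0r lmonom0.
Qed.

Lemma lmulUU u v a b : lmul (lmonom u a) (lmonom v b) = lmonom (u + v) (a * b).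
Proof.
by rewrite (lmulw msuppU_le msuppU_le) !big_seq_fset1 !lcoef_monom !eqxx.
Qed.

Lemma lmulC : commutative lmul.
Proof.
move=> f g; rewrite /lmul exchange_big; apply: eq_bigr => v _.
by apply: eq_bigr => u _; rewrite addrC mulrC.
Qed.

Lemma lmulDl : left_distributive lmul +%R.
Proof.
move=> f1 f2 f.
rewrite [X in _ = X + _](lmulw (fsubsetUl _ (msupp f2)) (fsubset_refl _)).
rewrite [X in _ = _ + X](lmulw (fsubsetUr (msupp f1) _) (fsubset_refl _)).
rewrite (lmulw (msuppD_le _ _) (fsubset_refl _)).
rewrite -big_split /=; apply: eq_bigr => u _.
rewrite -big_split /=; apply: eq_bigr => v _.
by rewrite [lcoef u (_ + _)]mcoeffD mulrDl lmonomD.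
Qed.

Lemma lmul0 : left_zero 0 lmul.
Proof. by move=> f; rewrite /lmul msupp0 big_seq_fset0. Qed.

Lemma lmul_suml I (r : seq I) (F : I -> L) g :
  lmul (\sum_(i <- r) F i) g = \sum_(i <- r) lmul (F i) g.
Proof. exact: (big_morph (lmul^~ g) (fun x y => lmulDl x y g) (lmul0 g)). Qed.

Lemma lmul_sumr I (r : seq I) (F : I -> L) g :
  lmul g (\sum_(i <- r) F i) = \sum_(i <- r) lmul g (F i).
Proof. by rewrite lmulC lmul_suml; apply: eq_bigr => i _; rewrite lmulC. Qed.

Lemma laurentE f : f = \sum_(u <- msupp f) lmonom u (lcoef u f).
Proof. exact: monalgE. Qed.

Lemma lmulA : associative lmul.
Proof.
move=> f g h; rewrite (laurentE f) !lmul_suml; apply: eq_bigr => u _.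
rewrite (laurentE g) !(lmul_suml, lmul_sumr); apply: eq_bigr => v _.
rewrite (laurentE h) !lmul_sumr; apply: eq_bigr => w _.
by rewrite !lmulUU addrA mulrA.
Qed.

Lemma lmul1 : left_id (lmonom 0 1) lmul.
Proof.
move=> f; rewrite [f in LHS]laurentE lmul_sumr [RHS]laurentE.
by apply: eq_bigr => u _; rewrite lmulUU add0r mul1r.
Qed.

Lemma lone_neq0 : lmonom 0 1 != 0.
Proof. by rewrite [_ == _]monalgU_eq0 oner_eq0. Qed.

HB.instance Definition _ := GRing.Zmodule_isComNzRing.Build L
  lmulA lmulC lmul1 lmulDl lone_neq0.

Definition lunit : pred L := fun f => `[< exists g : L, g * f = 1 >].

Definition linv f : L :=
  if pselect (exists g : L, g * f = 1) is left e then projT1 (cid e) else f.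

Lemma lmulV : {in lunit, left_inverse 1 linv *%R}.
Proof.
move=> f /asboolP ef; rewrite /linv; case: pselect => [e|//].
by case: (cid e).
Qed.

Lemma lunitP f g : g * f = 1 -> lunit f.
Proof. by move=> gf; apply/asboolP; exists g. Qed.

Lemma linv_out : {in [predC lunit], linv =1 id}.
Proof.
move=> f /negP nf; rewrite /linv; case: pselect => // e.
by case: nf; apply/asboolP.
Qed.

HB.instance Definition _ := GRing.ComNzRing_hasMulInverse.Build L
  lmulV lunitP linv_out.

Definition constant_term f : R := lcoef 0 f.

Definition lvar (i : 'I_n) : L := lmonom (delta_mx 0 i) 1.

Lemma lmonomM u v a b : lmonom u a * lmonom v b = lmonom (u + v) (a * b).
Proof. exact: lmulUU. Qed.

Lemma lvar_unit i : lvar i \is a GRing.unit.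
Proof.
apply/unitrP; exists (lmonom (- delta_mx 0 i) 1).
by rewrite /lvar !lmonomM mulr1 addNr addrN.
Qed.

Lemma lvarV i : (lvar i)^-1 = lmonom (- delta_mx 0 i) 1.
Proof.
apply: (mulrI (lvar_unit i)); rewrite divrr ?lvar_unit //.
by rewrite /lvar lmonomM addrN mulr1.
Qed.

End LaurentRing.

(* The formal power series \sum_d F_d q^d is the function d |-> F_d. *)
Section PowerSeries.
Variable A : comNzRingType.
Implicit Types F G : nat -> A.

Definition ps_const (c : A) : nat -> A := fun d => if d == 0%N then c else 0.

Definition ps_mul F G : nat -> A := fun d => \sum_(j < d.+1) F j * G (d - j)%N.

(* 1 / (1 - q M) = \sum_d M^d q^d *)
Definition ps_geom (M : A) : nat -> A := fun d => M ^+ d.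

Lemma ps_geomP (M : A) :
  ps_mul (fun d => if d == 0%N then 1 else if d == 1%N then - M else 0)
    (ps_geom M) =1 ps_const 1.
Proof.
move=> [|[|d]]; rewrite /ps_mul /ps_geom /ps_const.
- by rewrite big_ord_recl big_ord0 /= mul1r addr0.
- by rewrite !big_ord_recl big_ord0 /= mul1r addr0 mulr1 addrN.
rewrite !big_ord_recl /= big1 => [|i _]; last by rewrite mul0r.
by rewrite mul1r mul0r !addr0 subn0 mulNr subSS subn0 -exprS addrN.
Qed.

End PowerSeries.

Section Dimension.
Variables (F : fieldType) (V : lmodType F).

Definition is_basis (S : set V) (n : nat) (e : 'I_n -> V) : Prop :=
  [/\ forall i, S (e i),
      forall c : 'I_n -> F, \sum_i c i *: e i = 0 -> forall i, c i = 0
    & forall v, S v -> exists c : 'I_n -> F, v = \sum_i c i *: e i].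

(* Used only for finite-dimensional subspaces; 0 if there is no finite basis. *)
Definition dimension (S : set V) : nat :=
  xget 0%N [set n | exists e : 'I_n -> V, is_basis S e]%classic.

Lemma is_basis_leq (S : set V) m n (e : 'I_m -> V) (f : 'I_n -> V) :
  is_basis S e -> is_basis S f -> (m <= n)%N.
Proof.
move=> [Se e_free e_span] [Sf f_free f_span].
have /choice [a aE] i := f_span _ (Se i).
have /choice [b bE] j := e_span _ (Sf j).
pose A := \matrix_(i, j) a i j; pose B := \matrix_(i, j) b i j.
have AB1 : A *m B = 1%:M.
  have sumAB i : \sum_l (A *m B) i l *: e l = e i.
    under eq_bigr do rewrite mxE scaler_suml.
    rewrite exchange_big /= aE; apply: eq_bigr => j _.
    rewrite bE scaler_sumr; apply: eq_bigr => l _.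
    by rewrite !mxE scalerA.
  have sum1 i : \sum_l (1%:M : 'M[F]_m) i l *: e l = e i.
    rewrite (bigD1 i) //= mxE eqxx scale1r big1 ?addr0 // => l li.
    by rewrite mxE eq_sym (negPf li) scale0r.
  apply/matrixP => i l; apply/eqP; rewrite -subr_eq0; apply/eqP.
  apply: (e_free (fun l => (A *m B) i l - 1%:M i l)).
  by under eq_bigr do rewrite scalerBl; rewrite sumrB sumAB sum1 subrr.
by rewrite -(mxrank1 F m) -AB1 (leq_trans (mxrankM_maxr _ _)) ?rank_leq_row.
Qed.

Lemma dimension_basis (S : set V) n (e : 'I_n -> V) :
  is_basis S e -> dimension S = n.
Proof.
move=> Se; rewrite /dimension; case: xgetP => [m _ [f Sf]|/(_ n) []].
  by apply/eqP; rewrite eqn_leq (is_basis_leq Sf Se) (is_basis_leq Se Sf).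
by exists e.
Qed.

End Dimension.

Section Invariants.
Variables (R : realType) (k : nat).
Local Notation C := R[i].

(* A_1 (x) ... (x) A_k, from the blocks A (x) B = [a_ij B] of [tensmx]; the
   1 x 1 identity closes the recursion. *)
Fixpoint tensmx_iter (m : nat) : ('I_m -> 'M[C]_2) -> 'M[C]_(2 ^ m) :=
  if m is m'.+1 then fun A =>
    castmx (esym (expnS 2 m'), esym (expnS 2 m'))
      (tensmx (A ord0) (tensmx_iter (fun i => A (lift ord0 i))))
  else fun=> 1%:M.

(* P |-> P(xA), x a row vector: the variable x_j is replaced by (xA)_j. *)
Definition mpoly_act (n : nat) (A : 'M[C]_n) (P : {mpoly C[n]}) :
    {mpoly C[n]} :=
  P \mPo [tuple \sum_i A i j *: 'X_i | j < n].

Definition SL2_tensor_invariant (P : {mpoly C[2 ^ k]}) : Prop :=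
  forall A : 'I_k -> 'M[C]_2, (forall i, \det (A i) = 1) ->
    mpoly_act (tensmx_iter A) P = P.

Definition homog_invariants (d : nat) : set {mpoly C[2 ^ k]} :=
  [set P | P \is d.-homog /\ SL2_tensor_invariant P]%classic.

Definition hilbert_series (d : nat) : nat := dimension (homog_invariants d).

End Invariants.

Section WellDefined.

Lemma homog_subspace_basis (F : fieldType) (n d : nat)
    (S : set {mpoly F[n.+1]}) :
  (forall P, S P -> P \is d.-homog) -> S 0 ->
  (forall c P Q, S P -> S Q -> S (c *: P + Q)) ->
  exists m (e : 'I_m -> {mpoly F[n.+1]}), is_basis S e.
Proof.
move=> Shom S0 Slin; pose D := dhomog n.+1 F d.
pose T (U : {vspace D}) := forall P : D, P \in U -> S (val P).
pose p m := `[< exists2 U : {vspace D}, T U & \dim U = m >].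
have exp : exists m, p m.
  exists 0%N; apply/asboolP; exists 0%VS; last exact: dimv0.
  by move=> P /[!memv0] /eqP ->.
have pub m : p m -> (m <= \dim {:D})%N.
  by move=> /asboolP[U _ <-]; apply: dimvS (subvf U).
case: (ex_maxnP exp pub) => m /asboolP[U TU dimU] maxU.
have memU (P : D) : S (val P) -> P \in U.
  move=> SP; have TPU : T (<[P]> + U)%VS.
    by move=> _ /memv_addP[_ /vlineP[c ->] [Q QU ->]]; apply: Slin (TU _ QU).
  have le : (\dim (<[P]> + U) <= \dim U)%N.
    by rewrite dimU; apply: maxU; apply/asboolP; exists (<[P]> + U)%VS.
  have /eqP eqU : U == (<[P]> + U)%VS by rewrite eqEdim addvSr le.
  by rewrite eqU (subvP (addvSl _ _)) ?memv_line.
exists (\dim U), (fun i => val (vbasis U)`_i).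
have valsum (c : 'I_(\dim U) -> F) :
    \sum_i c i *: val (vbasis U)`_i = val (\sum_i c i *: (vbasis U)`_i : D).
  by rewrite raddf_sum; apply: eq_bigr.
split=> [i|c|P SP].
- by apply: TU; apply: vbasis_mem; rewrite mem_nth // size_tuple.
- rewrite valsum -(raddf0 (val : D -> _)) => /val_inj.
  move/freeP: (basis_free (vbasisP U)) => fr. exact: fr.
have PU := memU (DHomog (Shom P SP)) SP.
exists (fun i => coord (vbasis U) i (DHomog (Shom P SP))).
by rewrite valsum -coord_vbasis.
Qed.

Lemma hilbert_seriesP (R : realType) (k d : nat) :
  exists e : 'I_(hilbert_series R k d) -> {mpoly R[i][2 ^ k]},
    is_basis (@homog_invariants R k d) e.
Proof.
rewrite /hilbert_series; set S := homog_invariants _.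
suff [m [e Se]] : exists m (e : 'I_m -> {mpoly R[i][2 ^ k]}), is_basis S e.
  by have := dimension_basis Se => ->; exists e.
have : forall P, S P -> P \is d.-homog by move=> P [].
have : S 0 by split=> [|A _]; rewrite ?rpred0 // /mpoly_act raddf0.
have : forall c P Q, S P -> S Q -> S (c *: P + Q).
  move=> c P Q [hP iP] [hQ iQ]; split=> [|A A1].
    by rewrite rpredD ?rpredZ.
  by have := iP A A1; have := iQ A A1; rewrite /mpoly_act linearP /= => -> ->.
move: S; have : (0 < 2 ^ k)%N by rewrite expn_gt0.
case: (2 ^ k)%N => // n _ S Slin S0 Shom.
exact: homog_subspace_basis Shom S0 Slin.
Qed.

End WellDefined.

Section Expansion.
Variable k : nat.
Local Notation L := (laurent k int).

Definition weight_monomial (S : {set 'I_k}) : L :=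
  (\prod_(i in S) lvar int i) / (\prod_(j in ~: S) lvar int j).

Definition weight_expansion : nat -> L :=
  ps_mul (ps_const (\prod_(i < k) (1 - lvar int i ^+ 2)))
    (\big[@ps_mul L/ps_const 1]_(S : {set 'I_k}) ps_geom (weight_monomial S)).

End Expansion.

(* Main.v *)
From HB Require Import structures.
Require Import Defs.
From mathcomp Require Import all_boot all_order all_algebra.
From mathcomp Require Import reals.
From mathcomp Require Import complex mxtens mpoly.
From mathcomp Require Import ring zify.

(* The i-th factor SL(2) acts on polynomials through derivations E_i, F_i and
   H_i = [E_i, F_i]. As SL(2) is generated by unipotent matrices 1 + sN with
   N^2 = 0, and p(x(1 + sN)) is constant in s iff its derivative, the image of
   N p, vanishes, the invariants are the polynomials killed by all E_i and F_i,
   equivalently those of weight 0 killed by all F_i.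

   Monomials are weight vectors, and counting them by degree and weight gives
   exactly the expansion of the product of geometric series. It remains to see
   that imposing F_i p = 0 on weights u with u_i <= 1 amounts to multiplying
   the generating function by 1 - a_i^2, i.e. that F_i maps weight u onto weight
   u - 2 delta_i, even within the common kernel of other F_j. On that target the
   i-th weight is negative, so F_i E_i is injective there (sl2 theory), hence
   bijective by finite dimension; therefore F_i is surjective. *)

Set Implicit Arguments.
Unset Strict Implicit.
Unset Printing Implicit Defensive.

Import Order.TTheory GRing.Theory Num.Theory.
Local Open Scope ring_scope.

(** * Derivations and substitutions given by a matrix *)

(** Used to reduce identities between derivations, or between algebra morphisms, to constants and
    variables. *)
Lemma mpoly_alg_ind (n : nat) (R : comNzRingType) (P : {mpoly R[n]} -> Prop) :
  (forall c, P c%:MP) -> (forall i, P 'X_i) ->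
  (forall p q, P p -> P q -> P (p + q)) ->
  (forall p q, P p -> P q -> P (p * q)) -> forall p, P p.
Proof.
move=> PC PX PD PM; elim/mpolyind => [|c m p _ _ Pp]; first by rewrite -mpolyC0.
apply/PD => //; rewrite -mul_mpolyC; apply/PM => //; rewrite mpolyXE_id.
have P1 : P 1 by rewrite -mpolyC1.
apply: big_rec => [|i q _ Pq]; first exact: P1.
apply/PM => //; elim: (m i) => [|j IHj]; first by rewrite expr0.
by rewrite exprS; apply/PM.
Qed.

Section LinearDerivation.
Variables (n : nat) (R : comNzRingType).
Implicit Types (A B N : 'M[R]_n) (p q : {mpoly R[n]}).

(** The j-th coordinate of the row vector xA. *)
Definition linform A (j : 'I_n) : {mpoly R[n]} := \sum_i A i j *: 'X_i.

Lemma linform_is_linear j : linear (linform^~ j).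
Proof.
move=> c A B; rewrite /linform scaler_sumr -big_split; apply: eq_bigr => i _.
by rewrite !mxE scalerDl scalerA.
Qed.

Lemma linform0l j : linform 0 j = 0.
Proof. by rewrite /linform big1 // => i _; rewrite mxE scale0r. Qed.

Lemma linform_mul A B j : linform (A *m B) j = \sum_i B i j *: linform A i.
Proof.
rewrite /linform; under [RHS]eq_bigr do rewrite scaler_sumr.
rewrite exchange_big; apply: eq_bigr => l _ /=.
rewrite mxE scaler_suml; apply: eq_bigr => i _.
by rewrite scalerA mulrC.
Qed.

Lemma linear_linform (f : {linear {mpoly R[n]} -> {mpoly R[n]}}) A B j :
  (forall i, f 'X_i = linform A i) -> f (linform B j) = linform (A *m B) j.
Proof.
move=> fX; rewrite linform_mul linear_sum; apply: eq_bigr => i _.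
by rewrite linearZ /= fX.
Qed.

(** The derivative at t = 0 of p(x(1 + tA)), that is, the action of A as a linear vector field. *)
Definition linder A p := \sum_j linform A j * p^`M(j).

Lemma linder_is_linear A : linear (linder A).
Proof.
move=> c p q; rewrite /linder scaler_sumr -big_split; apply: eq_bigr => j _.
by rewrite linearP mulrDr scalerAr.
Qed.

HB.instance Definition _ A :=
  GRing.isLinear.Build R {mpoly R[n]} {mpoly R[n]} _ (linder A)
    (linder_is_linear A).

Lemma linder_is_linearl p : linear (linder^~ p).
Proof.
move=> c A B; rewrite /linder scaler_sumr -big_split; apply: eq_bigr => j _.
by rewrite linform_is_linear mulrDl scalerAl.
Qed.

Lemma linderDl A B p : linder (A + B) p = linder A p + linder B p.
Proof. by have := linder_is_linearl p 1 A B; rewrite !scale1r. Qed.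

Lemma linder0l p : linder 0 p = 0.
Proof.
by rewrite /linder big1 // => j _; rewrite linform0l mul0r.
Qed.

Lemma linderZl c A p : linder (c *: A) p = c *: linder A p.
Proof. by have := linder_is_linearl p c A 0; rewrite linder0l !addr0. Qed.

Lemma linderBl A B p : linder (A - B) p = linder A p - linder B p.
Proof. by rewrite linderDl -scaleN1r linderZl scaleN1r. Qed.

Lemma linderM A p q : linder A (p * q) = linder A p * q + p * linder A q.
Proof.
rewrite /linder mulr_suml mulr_sumr -big_split; apply: eq_bigr => j _ /=.
by rewrite mderivM; ring.
Qed.

Lemma linderC A c : linder A c%:MP = 0.
Proof. by rewrite /linder big1 // => j _; rewrite mderivC mulr0. Qed.

Lemma linderX A i : linder A 'X_i = linform A i.
Proof.
rewrite /linder (bigD1 i) //= mderivX mnm1E eqxx.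
have -> : (U_(i) - U_(i))%MM = 0%MM :> 'X_{1..n}.
  by apply/mnmP => l; rewrite mnmBE mnm0E subnn.
rewrite scale1r mpolyX0 mulr1 big1 ?addr0 // => j ji.
by rewrite mderivX mnm1E eq_sym (negPf ji) scale0r mulr0.
Qed.

(** Both sides are derivations that kill constants, so comparing them on variables suffices. This
    carries the relations of sl2 over to polynomials. *)
Lemma linder_commutator A B p :
  linder A (linder B p) - linder B (linder A p) = linder (A *m B - B *m A) p.
Proof.
elim/mpoly_alg_ind: p => [c|i|p q Hp Hq|p q Hp Hq].
- by rewrite !linderC !linear0 ?addr0.
- by rewrite linderBl !linderX !(linear_linform _ _ (linderX _)).
- by rewrite !linearD /= -Hp -Hq; ring.
by rewrite !linderM !linearD /= !linderM -Hp -Hq; ring.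
Qed.

Lemma linder_dhomog A d p : p \is d.-homog -> linder A p \is d.-homog.
Proof.
move=> /dhomogP hp; rewrite [p]mpolyE linear_sum big_seq.
rewrite rpred_sum // => m /hp md.
rewrite linearZ rpredZ // rpred_sum // => j _.
rewrite /linform mulr_suml rpred_sum // => i _; rewrite mderivX.
(* When [m j = 0] the subtraction [m - U_(j)] truncates, but the coefficient [m j] of the derivative
   vanishes. *)
have [->|mj] := eqVneq (m j) 0%N; first by rewrite scale0r mulr0 rpred0.
rewrite -scalerAl -scalerAr -mpolyXD !rpredZ // dhomogX.
have : mdeg (m - U_(j) + U_(j))%MM = d by rewrite submK ?lep1mP.
by rewrite /= !mdegD !mdeg1 addnC => ->.
Qed.

Lemma linder_diagX A m : (forall i j, i != j -> A i j = 0) ->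
  linder A 'X_[m] = (\sum_j A j j *+ m j) *: 'X_[m].
Proof.
move=> dA; rewrite /linder scaler_suml; apply: eq_bigr => j _.
have -> : linform A j = A j j *: 'X_j.
  rewrite /linform (bigD1 j) //= big1 ?addr0 // => i ij.
  by rewrite dA // scale0r.
rewrite mderivX; have [->|mj] := eqVneq (m j) 0%N.
  by rewrite scale0r mulr0 mulr0n scale0r.
rewrite -scalerAl -scalerAr -mpolyXD scalerA mulr_natr addmC submK ?lep1mP //.
Qed.

(** The action [mpoly_act], over an arbitrary commutative ring. *)
Definition linsubst A p := p \mPo [tuple \sum_i A i j *: 'X_i | j < n].

Lemma linsubst_is_linear A : linear (linsubst A).
Proof. by move=> c p q; rewrite /linsubst linearP. Qed.

Lemma linsubstD A p q : linsubst A (p + q) = linsubst A p + linsubst A q.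
Proof. exact: rmorphD. Qed.

Lemma linsubstM A p q : linsubst A (p * q) = linsubst A p * linsubst A q.
Proof. exact: rmorphM. Qed.

HB.instance Definition _ A :=
  GRing.isLinear.Build R {mpoly R[n]} {mpoly R[n]} _ (linsubst A)
    (linsubst_is_linear A).

Lemma linsubstX A i : linsubst A 'X_i = linform A i.
Proof. by rewrite /linsubst comp_mpolyXU -tnth_nth tnth_mktuple. Qed.

(** With row vectors the order is preserved: evaluating p(xB) at xA gives p(xAB). *)
Lemma linsubst_mul A B p : linsubst A (linsubst B p) = linsubst (A *m B) p.
Proof.
elim/mpoly_alg_ind: p => [c|i|p q Hp Hq|p q Hp Hq].
- by rewrite /linsubst !comp_mpolyC.
- by rewrite !linsubstX (linear_linform _ _ (linsubstX _)).
- by rewrite !linsubstD Hp Hq.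
by rewrite !linsubstM Hp Hq.
Qed.

End LinearDerivation.

Lemma linsubst1 (n : nat) (R : comNzRingType) (p : {mpoly R[n]}) :
  linsubst 1%:M p = p.
Proof.
rewrite /linsubst -[RHS](comp_mpoly_id); congr (_ \mPo _).
apply: eq_from_tnth => j; rewrite !tnth_mktuple (bigD1 j) //= mxE eqxx.
by rewrite scale1r big1 ?addr0 // => i ij; rewrite mxE (negPf ij) scale0r.
Qed.

(** * Unipotent one-parameter groups and their infinitesimal generators *)

Lemma deriv_eq0 (S : idomainType) (f : {poly S}) :
  (forall m : nat, m.+1%:R != 0 :> S) -> f^`() = 0 -> f = (f`_0)%:P.
Proof.
move=> S0 f0; apply/polyP => -[|m]; rewrite coefC //=.
have := congr1 (coefp m) f0; rewrite /= coef_deriv coef0 => /eqP.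
by rewrite -mulr_natr mulf_eq0 (negPf (S0 m)) orbF => /eqP.
Qed.

Section OneParameterGroup.
Variables (n : nat) (R : numDomainType) (N : 'M[R]_n).
Hypothesis N2 : N *m N = 0.
Implicit Type p : {mpoly R[n]}.

(* [p |-> p(x (1 + tN))] as a polynomial in [t]. *)
Variable oneparam : {rmorphism {mpoly R[n]} -> {poly {mpoly R[n]}}}.
Hypothesis oneparamC : forall c, oneparam c%:MP = c%:MP%:P.
Hypothesis oneparamX :
  forall i, oneparam 'X_i = ('X_i)%:P + 'X * (linform N i)%:P.

Let oneparam_linform A i :
  oneparam (linform A i) = (linform A i)%:P + 'X * (linform (N *m A) i)%:P.
Proof.
rewrite linform_mul /linform !rmorph_sum mulr_sumr -big_split /=.
apply: eq_bigr => j _; rewrite -!mul_mpolyC rmorphM oneparamC oneparamX.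
by rewrite !polyCM mulrDr mulrCA.
Qed.

Lemma horner_oneparam s p : (oneparam p).[s%:MP] = linsubst (1%:M + s *: N) p.
Proof.
elim/mpoly_alg_ind: p => [c|i|p q Hp Hq|p q Hp Hq].
- by rewrite oneparamC hornerC /linsubst comp_mpolyC.
- rewrite oneparamX linsubstX !hornerE /= addrC.
  rewrite [1%:M + _]addrC linform_is_linear; congr (_ + _); last first.
    rewrite /linform (bigD1 i) //= mxE eqxx scale1r big1 ?addr0 // => j ji.
    by rewrite mxE (negPf ji) scale0r.
  by rewrite mul_mpolyC.
- by rewrite rmorphD hornerD Hp Hq linsubstD.
by rewrite rmorphM hornerM Hp Hq linsubstM.
Qed.

(** Because N^2 = 0, [oneparam] fixes every [linform N i], which settles the variables; the Leibniz
    rules on both sides do the rest. *)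
Lemma deriv_oneparam p : (oneparam p)^`() = oneparam (linder N p).
Proof.
elim/mpoly_alg_ind: p => [c|i|p q Hp Hq|p q Hp Hq].
- by rewrite oneparamC derivC linderC -mpolyC0 oneparamC.
- rewrite oneparamX linderX oneparam_linform N2 linform0l polyC0 mulr0 addr0.
  by rewrite !derivE mul1r mulr0 addr0 add0r.
- by rewrite rmorphD derivD Hp Hq linearD rmorphD.
by rewrite rmorphM derivM Hp Hq linderM rmorphD !rmorphM.
Qed.

Let natr_mpoly_neq0 m : m.+1%:R != 0 :> {mpoly R[n]}.
Proof. by rewrite -mpolyC_nat mpolyC_eq0 pnatr_eq0. Qed.

Lemma oneparam_unipotentP p :
  (forall s, linsubst (1%:M + s *: N) p = p) <-> linder N p = 0.
Proof.
split=> [inv|Np0 s].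
- suff fix_p : oneparam p = p%:P.
    have := deriv_oneparam p; rewrite fix_p derivC.
    move=> /esym/(congr1 (horner^~ 0)).
    by rewrite -mpolyC0 horner_oneparam hornerC scale0r addr0 linsubst1.
  apply/eqP; rewrite -subr_eq0; apply/negPn/negP => nz.
  (* If [oneparam p - p] were nonzero, the integers below its size would be distinct roots, one more
     than its degree allows. *)
  pose rs : seq {mpoly R[n]} :=
    [seq m%:R | m <- iota 0 (size (oneparam p - p%:P))].
  have := @max_poly_roots _ _ rs nz; rewrite size_map size_iota ltnn.
  suff [-> ->] : all (root (oneparam p - p%:P)) rs /\ uniq rs.
    by move/(_ isT isT).
  split.
    apply/allP => _ /mapP[m _ ->]; rewrite /root -mpolyC_nat !hornerE.
    by rewrite horner_oneparam inv subrr.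
  rewrite map_inj_uniq ?iota_uniq // => a b.
  move=> /(congr1 (mcoeff 0%MM)); rewrite -!mpolyC_nat !mcoeffC eqxx !mulr1.
  by move=> /eqP; rewrite eqr_nat => /eqP.
have const : oneparam p = ((oneparam p)`_0)%:P.
  apply: deriv_eq0 => //; rewrite deriv_oneparam Np0 -mpolyC0 oneparamC.
  by rewrite mpolyC0 polyC0.
rewrite -horner_oneparam const hornerC.
have := horner_oneparam 0 p.
by rewrite const !hornerC coefC scale0r addr0 linsubst1.
Qed.

End OneParameterGroup.

Lemma linsubst_unipotentP (n : nat) (R : numDomainType) (N : 'M[R]_n) p :
  N *m N = 0 -> (forall s, linsubst (1%:M + s *: N) p = p) <-> linder N p = 0.
Proof.
move=> N2; pose h j := ('X_j)%:P + 'X * (linform N j)%:P.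
apply: (@oneparam_unipotentP _ _ _ N2 (mmap (polyC \o @mpolyC n R) h)) => [c|i].
  by rewrite /= mmapC.
by rewrite /= mmapX mmap1U.
Qed.

(** * Injectivity from the sl2 relations *)

Section Sl2Triple.
Variables (F : numFieldType) (V : lmodType F) (e f h : {linear V -> V}).
Hypothesis ef : forall x, e (f x) - f (e x) = h x.
Hypothesis he : forall x, h (e x) - e (h x) = 2 *: e x.

(* Induction on [N]: [e (e f + c) = (e f + c + lam) e] on the
   [lam]-eigenspace of [h]. *)
Lemma sl2_injective N c lam x :
  0 < lam -> 0 <= c -> h x = lam *: x -> iter N e x = 0 ->
  e (f x) + c *: x = 0 -> x = 0.
Proof.
elim: N c lam x => [//|N IHN] c lam x lam0 c0 hx eNx efx.
have efxE : e (f x) = - (c *: x) by apply/eqP; rewrite -addr_eq0 efx.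
have fex : f (e x) = - (c *: x) - lam *: x.
  by rewrite -hx -ef efxE opprD !opprK addrA addNr add0r.
have ex0 : e x = 0.
  apply: (IHN (c + lam) (lam + 2)).
  - by rewrite addr_gt0.
  - by rewrite addr_ge0 // ltW.
  - by apply/eqP; rewrite scalerDl -he hx linearZ addrC subrK.
  - by rewrite -iterSr.
  by rewrite fex linearD !linearN !linearZ /= !scalerN scalerDl -opprD addNr.
(* Once [e x = 0], the formula for [f (e x)] says that x is killed by c + lam, which is positive. *)
have : (c + lam) *: x = 0.
  apply/eqP; rewrite scalerDl -oppr_eq0 opprD -fex ex0 linear0 //.
move/eqP; rewrite scaler_eq0 => /orP[|/eqP //].
by rewrite gt_eqF // ltr_wpDl.
Qed.

End Sl2Triple.

(** * The matrices of sl2 and generators of SL(2) *)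

Section SL2.
Variable F : fieldType.
Implicit Types A B : 'M[F]_2.

Definition sl2E : 'M[F]_2 := delta_mx 0 1.
Definition sl2F : 'M[F]_2 := delta_mx 1 0.
Definition sl2H : 'M[F]_2 := \matrix_(i, j) ((-1) ^+ i *+ (i == j)).

Lemma mx2P A B : A 0 0 = B 0 0 -> A 0 1 = B 0 1 -> A 1 0 = B 1 0 ->
  A 1 1 = B 1 1 -> A = B.
Proof.
move=> AB00 AB01 AB10 AB11; apply/matrixP => i j.
have ord2 (l : 'I_2) : l = 0 \/ l = 1.
  by case: l => [[|[|[]]]] // ?; [left|right]; apply: val_inj.
by case: (ord2 i) => ->; case: (ord2 j) => ->.
Qed.

Lemma mulmx2E A B i j : (A *m B) i j = A i 0 * B 0 j + A i 1 * B 1 j.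
Proof.
rewrite mxE !big_ord_recl big_ord0 addr0.
by congr (_ + A i _ * B _ j); apply: val_inj.
Qed.


Lemma sl2E2 : sl2E *m sl2E = 0.
Proof. by apply: mx2P; rewrite mulmx2E !mxE /=; ring. Qed.

Lemma sl2F2 : sl2F *m sl2F = 0.
Proof. by apply: mx2P; rewrite mulmx2E !mxE /=; ring. Qed.

Lemma sl2EF : sl2E *m sl2F - sl2F *m sl2E = sl2H.
Proof.
by apply: mx2P; rewrite mxE [(- (_ *m _)) _ _]mxE !mulmx2E !mxE /=
  ?expr0 ?expr1; ring.
Qed.

Lemma sl2HE : sl2H *m sl2E - sl2E *m sl2H = 2 *: sl2E.
Proof.
by apply: mx2P; rewrite mxE [(- (_ *m _)) _ _]mxE !mulmx2E !mxE /=
  ?expr0 ?expr1; ring.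
Qed.

Lemma sl2HF : sl2H *m sl2F - sl2F *m sl2H = - (2 *: sl2F).
Proof.
by apply: mx2P; rewrite mxE [(- (_ *m _)) _ _]mxE !mulmx2E !mxE /=
  ?expr0 ?expr1; ring.
Qed.

Lemma det2 A : \det A = A 0 0 * A 1 1 - A 0 1 * A 1 0.
Proof.
rewrite (expand_det_row _ 0) !big_ord_recl big_ord0 /cofactor !det_mx11 !mxE.
rewrite addr0 /= expr0 mul1r expr1 mulN1r mulrN.
by congr (A _ _ * A _ _ - A _ _ * A _ _); apply: val_inj.
Qed.

Lemma det_unipotentE s : \det (1%:M + s *: sl2E) = 1.
Proof. by rewrite det2 !mxE /=; ring. Qed.

Lemma det_unipotentF s : \det (1%:M + s *: sl2F) = 1.
Proof. by rewrite det2 !mxE /=; ring. Qed.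

(** A matrix of determinant 1 with lower left entry c != 0 is a product of upper, lower and upper
    unipotents. If c = 0, right multiplication by 1 + [sl2F] turns that entry into d, which is
    nonzero as ad = 1. *)
Lemma SL2_ind (P : 'M[F]_2 -> Prop) :
  (forall s, P (1%:M + s *: sl2E)) -> (forall s, P (1%:M + s *: sl2F)) ->
  (forall A B, P A -> P B -> P (A *m B)) ->
  forall A, \det A = 1 -> P A.
Proof.
move=> PE PF PM.
have P0 A : \det A = 1 -> A 1 0 != 0 -> P A.
  rewrite det2; set a := A 0 0; set b := A 0 1; set c := A 1 0; set d := A 1 1.
  move=> detA c0.
  have -> : A = (1%:M + ((a - 1) / c) *: sl2E) *m
                ((1%:M + c *: sl2F) *m (1%:M + ((d - 1) / c) *: sl2E)).
    have bE : b = (a * d - 1) / c by rewrite -detA; field.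
    apply: mx2P; rewrite !mulmx2E !mxE /= -/a -/b -/c -/d; last 1 first.
    - by field.
    - by field.
    - by rewrite bE; field.
    - by field.
  by apply/PM => //; apply/PM.
move=> A detA; have [c0|] := eqVneq (A 1 0) 0; last exact: P0.
have detAF : \det (A *m (1%:M + 1 *: sl2F)) = 1.
  by rewrite det_mulmx detA det_unipotentF mulr1.
have -> : A = (A *m (1%:M + 1 *: sl2F)) *m (1%:M + (-1) *: sl2F).
  by apply: mx2P; rewrite !mulmx2E !mxE /=; ring.
apply/PM => //; apply: P0 => //.
rewrite mulmx2E !mxE /= c0; apply/eqP => d0.
move: detA; rewrite det2 c0 (_ : A 1 1 = 0) ?mulr0 ?subr0; last first.
  by rewrite -d0; ring.
by move/esym/eqP; rewrite oner_eq0.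
Qed.

End SL2.

(** * Tensor powers of 2 x 2 matrices *)

(* Row [a] of a [k]-fold tensor product is indexed by the digits [sigma a]. *)
Section TensorPower.
Variables (F : fieldType) (k n : nat) (sigma : 'I_n -> {ffun 'I_k -> 'I_2}).
Hypothesis sigma_bij : bijective sigma.
Implicit Types (A : 'I_k -> 'M[F]_2) (B : 'M[F]_2).

Definition tens A : 'M[F]_n :=
  \matrix_(a, b) \prod_i A i (sigma a i) (sigma b i).

Lemma eq_tens A A' : (forall i, A i = A' i) -> tens A = tens A'.
Proof.
move=> eqA; apply/matrixP => a b; rewrite !mxE.
by apply: eq_bigr => i _; rewrite eqA.
Qed.

(** Distributing the product of the k row-by-column sums yields a sum over all digit vectors, each
    enumerated once by [sigma]. *)
Lemma tens_mul A A' : tens A *m tens A' = tens (fun i => A i *m A' i).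
Proof.
apply/matrixP => a b; rewrite !mxE.
under [RHS]eq_bigr do rewrite mxE.
rewrite bigA_distr_bigA /= (reindex sigma) /=; last exact: onW_bij.
by apply: eq_bigr => c _; rewrite !mxE -big_split.
Qed.

Lemma tens1 : tens (fun=> 1%:M) = 1%:M.
Proof.
apply/matrixP => a b; rewrite !mxE; have [->|ab] := eqVneq a b.
  by rewrite big1 // => i _; rewrite mxE eqxx.
have [i abi] : exists i, sigma a i != sigma b i.
  apply/existsP; apply: contraNT ab; rewrite negb_exists => /forallP eq_ab.
  apply/eqP/(bij_inj sigma_bij)/ffunP => i.
  by apply/eqP; rewrite -[_ == _]negbK eq_ab.
by rewrite (bigD1 i) //= mxE (negPf abi) mul0r.
Qed.

Definition at_factor i B : 'I_k -> 'M[F]_2 :=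
  fun j => if j == i then B else 1%:M.

(** The tensor product with B in position i and identities elsewhere. It is multiplicative and
    linear in B, so it serves both for SL(2) and for its Lie algebra. *)
Definition tens_at i B := tens (at_factor i B).

Lemma tens_atE i B a b : tens_at i B a b =
  B (sigma a i) (sigma b i) * \prod_(j | j != i) (sigma a j == sigma b j)%:R.
Proof.
rewrite mxE (bigD1 i) //= /at_factor eqxx; congr (_ * _).
by apply: eq_bigr => j /negPf ->; rewrite mxE.
Qed.

Lemma tens_at_mul i B B' : tens_at i B *m tens_at i B' = tens_at i (B *m B').
Proof.
rewrite tens_mul; apply: eq_tens => j; rewrite /at_factor.
by case: eqP => // _; rewrite mulmx1.
Qed.

Lemma tens_at_comm i j B B' : i != j ->
  tens_at i B *m tens_at j B' = tens_at j B' *m tens_at i B.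
Proof.
move=> ij; rewrite !tens_mul; apply: eq_tens => l; rewrite /at_factor.
have [->|] := eqVneq l i; last by rewrite mul1mx mulmx1.
by rewrite (negPf ij) mul1mx mulmx1.
Qed.

Lemma tens_at1 i : tens_at i 1%:M = 1%:M.
Proof.
by rewrite -tens1; apply: eq_tens => j; rewrite /at_factor; case: eqP.
Qed.

Lemma tens_at_is_linear i : linear (tens_at i).
Proof.
move=> c B B'; apply/matrixP => a b; rewrite [RHS]mxE [X in _ = X + _]mxE.
by rewrite !tens_atE !mxE mulrDl mulrA.
Qed.

HB.instance Definition _ i :=
  GRing.isLinear.Build F 'M[F]_2 'M[F]_n _ (tens_at i) (tens_at_is_linear i).

Lemma tens_at_diag i B : (forall r s, r != s -> B r s = 0) ->
  forall a b, a != b -> tens_at i B a b = 0.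
Proof.
move=> dB a b ab; rewrite tens_atE.
have [eqi|/dB ->] := eqVneq (sigma a i) (sigma b i); last by rewrite mul0r.
(* The digits at i agree, so the off-diagonal entry of [tens_at i 1 = 1] is exactly the product over
   j != i, which is therefore 0. *)
have : (1%:M : 'M[F]_n) a b = 0 by rewrite mxE (negPf ab).
by rewrite -(tens_at1 i) tens_atE mxE eqi eqxx mul1r => ->; rewrite mulr0.
Qed.

Lemma tens_at_diagE i B a : tens_at i B a a = B (sigma a i) (sigma a i).
Proof. by rewrite tens_atE big1 ?mulr1 // => j _; rewrite eqxx. Qed.

End TensorPower.

(** * From group invariants to Lie algebra invariants *)

Section InvariantsLie.
Variables (F : numFieldType) (k n : nat) (sigma : 'I_n -> {ffun 'I_k -> 'I_2}).
Hypothesis sigma_bij : bijective sigma.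
Local Notation tens := (tens sigma).
Local Notation T := (tens_at sigma).

Lemma tens_at_unipotent i s (B : 'M[F]_2) :
  T i (1%:M + s *: B) = 1%:M + s *: T i B.
Proof. by rewrite linearD linearZ /= tens_at1. Qed.

(** Left to right, test invariance on unipotents in one factor. Right to left, [SL2_ind] gives
    invariance under each single factor, and any tensor is a product of such factors. *)
Lemma tens_invariantP (p : {mpoly F[n]}) :
  (forall A : 'I_k -> 'M[F]_2, (forall i, \det (A i) = 1) ->
     linsubst (tens A) p = p) <->
  (forall i, linder (T i (sl2E F)) p = 0 /\ linder (T i (sl2F F)) p = 0).
Proof.
have nilE i : T i (sl2E F) *m T i (sl2E F) = 0.
  by rewrite tens_at_mul // sl2E2 linear0.
have nilF i : T i (sl2F F) *m T i (sl2F F) = 0.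
  by rewrite tens_at_mul // sl2F2 linear0.
split=> [inv i|killed].
  have inv_at B : \det B = 1 -> linsubst (T i B) p = p.
    by move=> B1; apply: inv => j; rewrite /at_factor; case: eqP; rewrite ?det1.
  split; apply/linsubst_unipotentP => // s; rewrite -tens_at_unipotent.
    by rewrite inv_at // det_unipotentE.
  by rewrite inv_at // det_unipotentF.
have inv_at i B : \det B = 1 -> linsubst (T i B) p = p.
  move: B; apply: SL2_ind => [s|s|A B pA pB].
  - rewrite tens_at_unipotent; move: s; apply/linsubst_unipotentP => //.
    by case: (killed i).
  - rewrite tens_at_unipotent; move: s; apply/linsubst_unipotentP => //.
    by case: (killed i).
  by rewrite -tens_at_mul // -linsubst_mul pB.
(* [C s] keeps the factors indexed by s and puts 1 elsewhere, so that the factors can be multiplied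
   in one at a time. *)
move=> A detA; pose C (s : seq 'I_k) j := if j \in s then A j else 1%:M.
rewrite (_ : tens A = tens (C (enum 'I_k))); last first.
  by apply: eq_tens => j; rewrite /C mem_enum.
elim: (enum 'I_k) (enum_uniq 'I_k) => [_|i s IHs /= /andP[i_s us]].
  rewrite (_ : tens _ = 1%:M) ?linsubst1 // -(tens1 _ sigma_bij).
  exact: eq_tens.
rewrite (_ : tens _ = T i (A i) *m tens (C s)).
  by rewrite -linsubst_mul IHs // inv_at.
rewrite tens_mul //; apply: eq_tens => j; rewrite /C /at_factor inE.
have [->|] := eqVneq j i; first by rewrite (negPf i_s) mulmx1.
by rewrite mul1mx.
Qed.

End InvariantsLie.

(** * Weights of polynomials and the operators E, F, H *)

Lemma mcoeff_linder_diag (n : nat) (R : comNzRingType) (A : 'M[R]_n) p m :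
  (forall i j, i != j -> A i j = 0) ->
  (linder A p)@_m = (\sum_j A j j *+ m j) * p@_m.
Proof.
move=> dA; elim/mpolyind: p => [|c m' p _ _ IHp].
  by rewrite linear0 !mcoeff0 mulr0.
rewrite linearP /= linder_diagX // !mcoeffD IHp !mcoeffZ mcoeffX mulrDr.
by have [->|_] := eqVneq m' m; rewrite ?mulr1 ?mulr0 // mulrC.
Qed.

Section WeightSpaces.
Variables (F : numFieldType) (k n : nat) (sigma : 'I_n -> {ffun 'I_k -> 'I_2}).
Hypothesis sigma_bij : bijective sigma.
Implicit Types (p : {mpoly F[n]}) (u : 'rV[int]_k).

Definition opE i : {linear {mpoly F[n]} -> {mpoly F[n]}} :=
  linder (tens_at sigma i (sl2E F)).
Definition opF i : {linear {mpoly F[n]} -> {mpoly F[n]}} :=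
  linder (tens_at sigma i (sl2F F)).
Definition opH i : {linear {mpoly F[n]} -> {mpoly F[n]}} :=
  linder (tens_at sigma i (sl2H F)).
(** The Cartan element of the opposite triple (F, E, -H), to which [sl2_injective] is applied in
    [opFE_injective]. *)
Definition opHN i : {linear {mpoly F[n]} -> {mpoly F[n]}} :=
  linder (tens_at sigma i (- sl2H F)).

(** Each variable contributes +1 or -1 to the i-th weight according as its i-th digit is 0 or 1. *)
Definition weight (m : 'X_{1..n}) : 'rV[int]_k :=
  \row_i \sum_a (-1) ^+ sigma a i *+ m a.

Definition has_weight u p := forall i, opH i p = (u 0 i)%:~R *: p.

Lemma mcoeff_opH i p m : (opH i p)@_m = (weight m 0 i)%:~R * p@_m.
Proof.
rewrite mcoeff_linder_diag => [|a b ab]; last first.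
  by apply: (tens_at_diag sigma_bij) ab => r s rs; rewrite mxE (negPf rs).
rewrite mxE rmorph_sum; congr (_ * _); apply: eq_bigr => a _.
by rewrite tens_at_diagE mxE eqxx mulr1n rmorphMn rmorphXn rmorphN1.
Qed.

(** The operators [opH i] are diagonal on monomials, and distinct integer weights stay distinct in
    characteristic 0. *)
Lemma has_weightP u p :
  has_weight u p <-> (forall m, p@_m != 0 -> weight m = u).
Proof.
split=> [up m pm|supp i]; last first.
  apply/mpolyP => m; rewrite mcoeff_opH mcoeffZ.
  by have [->|/supp ->//] := eqVneq p@_m 0; rewrite !mulr0.
apply/rowP => i; have /(congr1 (mcoeff m)) := up i.
by rewrite mcoeff_opH mcoeffZ => /(mulIf pm)/eqP; rewrite eqr_int => /eqP.
Qed.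

Lemma commutator_tens_at_same i B C p :
  linder (tens_at sigma i B) (linder (tens_at sigma i C) p) -
  linder (tens_at sigma i C) (linder (tens_at sigma i B) p) =
  linder (tens_at sigma i (B *m C - C *m B)) p.
Proof. by rewrite linder_commutator !tens_at_mul // linearB. Qed.

Lemma commutator_tens_at_neq i j B C p : i != j ->
  linder (tens_at sigma i B) (linder (tens_at sigma j C) p) =
  linder (tens_at sigma j C) (linder (tens_at sigma i B) p).
Proof.
move=> ij; apply/eqP; rewrite -subr_eq0 linder_commutator.
by rewrite tens_at_comm // subrr linder0l.
Qed.

Lemma opFF_comm i j p : i != j -> opF i (opF j p) = opF j (opF i p).
Proof. exact: commutator_tens_at_neq. Qed.

Lemma opFE_comm i j p : i != j -> opF i (opE j p) = opE j (opF i p).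
Proof. exact: commutator_tens_at_neq. Qed.

Lemma opEF i p : opE i (opF i p) - opF i (opE i p) = opH i p.
Proof. by rewrite commutator_tens_at_same sl2EF. Qed.

Lemma opHE i p : opH i (opE i p) - opE i (opH i p) = 2 *: opE i p.
Proof. by rewrite commutator_tens_at_same sl2HE linearZ linderZl. Qed.

Lemma opHF i p : opH i (opF i p) - opF i (opH i p) = - (2 *: opF i p).
Proof.
by rewrite commutator_tens_at_same sl2HF -scaleNr linearZ linderZl scaleNr.
Qed.

Lemma opHNE i p : opHN i p = - opH i p.
Proof. by rewrite /opHN -scaleN1r linearZ /= linderZl scaleN1r. Qed.

Lemma has_weight_opE u j p :
  has_weight u p -> has_weight (u + delta_mx 0 j *+ 2) (opE j p).
Proof.
move=> up i; rewrite mxE mulmxnE !mxE eqxx rmorphD scalerDl /=.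
have [->|ij] := eqVneq j i.
  have /eqP := opHE i p; rewrite subr_eq => /eqP ->.
  by rewrite up linearZ addrC.
rewrite mul0rn scale0r addr0.
by rewrite /opH /opE commutator_tens_at_neq 1?eq_sym // -/(opH i) up linearZ.
Qed.

Lemma has_weight_opF u j p :
  has_weight u p -> has_weight (u - delta_mx 0 j *+ 2) (opF j p).
Proof.
move=> up i; rewrite mxE [X in _ + X]mxE mulmxnE !mxE eqxx rmorphB scalerBl /=.
have [->|ij] := eqVneq j i.
  have /eqP := opHF i p; rewrite subr_eq => /eqP ->.
  by rewrite up addrC; congr (_ - _); exact: linearZ.
rewrite mul0rn scale0r subr0.
by rewrite /opH /opF commutator_tens_at_neq 1?eq_sym // -/(opH i) up linearZ.
Qed.

Lemma weight_bound m i : `|weight m 0 i| <= (mdeg m)%:Z.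
Proof.
rewrite mxE mdegE (le_trans (ler_norm_sum _ _ _)) //.
rewrite (big_morph Posz PoszD (erefl _)); apply: ler_sum => a _.
by rewrite normrMn normrX normrN1 expr1n -[_ *+ _]mulr_natr mul1r natz.
Qed.

Lemma has_weight_eq0 d u p i :
  p \is d.-homog -> has_weight u p -> d%:Z < `|u 0 i| -> p = 0.
Proof.
move=> hp /has_weightP up du; apply/mpolyP => m; rewrite mcoeff0.
apply/eqP/negPn/negP => pm; have := weight_bound m i.
rewrite (up m pm) leNgt => /negP; apply.
by move/dhomogP: hp => /(_ m); rewrite mcoeff_msupp pm => /(_ isT) /= ->.
Qed.

(** Each step adds 2 to the i-th weight and keeps the degree d, which bounds the weight; after d +
    |u_i| + 1 steps the weight exceeds d. *)
Lemma opE_nilpotent d u p i : p \is d.-homog -> has_weight u p ->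
  iter (d + `|u 0 i|).+1 (opE i) p = 0.
Proof.
move=> hp up; set N := _.+1.
have [hN uN] : iter N (opE i) p \is d.-homog /\
    has_weight (u + delta_mx 0 i *+ (2 * N)) (iter N (opE i) p).
  elim: N => [|N [IHh IHu]]; first by rewrite muln0 mulr0n addr0.
  split; first exact: linder_dhomog.
  by rewrite mulnS addnC mulrnDr addrA; apply: has_weight_opE.
apply: (has_weight_eq0 (i := i) hN uN).
by rewrite mxE mulmxnE !mxE !eqxx /= /N; lia.
Qed.

Lemma opF_nilpotent d u p i : p \is d.-homog -> has_weight u p ->
  iter (d + `|u 0 i|).+1 (opF i) p = 0.
Proof.
move=> hp up; set N := _.+1.
have [hN uN] : iter N (opF i) p \is d.-homog /\
    has_weight (u - delta_mx 0 i *+ (2 * N)) (iter N (opF i) p).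
  elim: N => [|N [IHh IHu]]; first by rewrite muln0 mulr0n subr0.
  split; first exact: linder_dhomog.
  by rewrite mulnS addnC mulrnDr opprD addrA; apply: has_weight_opF.
apply: (has_weight_eq0 (i := i) hN uN).
by rewrite mxE [X in _ + X]mxE mulmxnE !mxE !eqxx /= /N; lia.
Qed.

Lemma opEF_injective d u p i : p \is d.-homog -> has_weight u p ->
  0 < u 0 i -> opE i (opF i p) = 0 -> p = 0.
Proof.
move=> hp up u0 efp.
have nilp := opE_nilpotent i hp up.
apply: (sl2_injective (opEF i) (opHE i) _ (lexx 0) (up i) nilp).
  by rewrite ltr0z.
by rewrite efp scale0r addr0.
Qed.

Lemma opFE_injective d u p i : p \is d.-homog -> has_weight u p ->
  u 0 i < 0 -> opF i (opE i p) = 0 -> p = 0.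
Proof.
move=> hp up u0 fep.
have fe q : opF i (opE i q) - opE i (opF i q) = opHN i q.
  by rewrite opHNE -opEF opprB.
have hf q : opHN i (opF i q) - opF i (opHN i q) = 2 *: opF i q.
  rewrite (opHNE i (opF i q)) (opHNE i q) [opF i (- _)]linearN.
  by rewrite -opprD opHF opprK.
have hu : opHN i p = (- (u 0 i)%:~R) *: p by rewrite opHNE up scaleNr.
apply: (sl2_injective fe hf _ (lexx 0) hu (opF_nilpotent i hp up)).
  by rewrite oppr_gt0 ltrz0.
by rewrite fep scale0r addr0.
Qed.

(** Left to right, H = [E, F]. Conversely, at weight 0 [opEF] turns [F p = 0] into [F (E p) = 0]; as
    [E p] has weight 2 > 0, [opEF_injective] gives [E p = 0]. *)
Lemma killed_opEP d p : p \is d.-homog ->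
  (forall i, opE i p = 0 /\ opF i p = 0) <->
  has_weight 0 p /\ (forall i, opF i p = 0).
Proof.
move=> hp; split=> [killed|[up Fp i]].
  split=> i; last by case: (killed i).
  by case: (killed i) => Ep Fp; rewrite -opEF Ep Fp !linear0 addr0 mxE scale0r.
split=> //.
apply: (@opEF_injective d (0 + delta_mx 0 i *+ 2) _ i).
- exact: linder_dhomog.
- exact: has_weight_opE.
- by rewrite mxE mulmxnE !mxE !eqxx.
have /eqP := opEF i p; rewrite up mxE scale0r Fp linear0 sub0r oppr_eq0.
move=> /eqP ->.
exact: linear0.
Qed.

End WeightSpaces.

(** * Coefficients of Laurent polynomials *)

Section LaurentCoefficients.
Variables (k : nat).
Local Notation L := (laurent k int).
Implicit Types (u v : 'rV[int]_k) (f g : L).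

Lemma lcoef_monomM u v g : lcoef u (lmonom v 1 * g) = lcoef (u - v) g.
Proof.
rewrite [in LHS](laurentE g) mulr_sumr lcoef_sum [in RHS](laurentE g) lcoef_sum.
apply: eq_bigr => w _; rewrite lmonomM mul1r !lcoef_monom.
by rewrite [w == _]eq_sym subr_eq addrC eq_sym.
Qed.

Lemma lcoefB u f g : lcoef u (f - g) = lcoef u f - lcoef u g.
Proof. exact: (monalg.mcoeffB u f g). Qed.

Lemma lmonomX v j : lmonom v 1 ^+ j = lmonom (v *+ j) (1 : int).
Proof.
by elim: j => [|j IHj]; rewrite ?expr0 // exprS IHj lmonomM mulr1 mulrS.
Qed.

(** The difference on the right is matched below with rank-nullity for F_i, which lowers the i-th
    weight by 2. *)
Lemma lcoef_weyl_factor u i g :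
  lcoef u ((1 - lvar int i ^+ 2) * g) =
  lcoef u g - lcoef (u - delta_mx 0 i *+ 2) g.
Proof. by rewrite mulrBl mul1r lcoefB lmonomX lcoef_monomM. Qed.

End LaurentCoefficients.

(** * Dimensions of spaces of lowest weight vectors *)

Section HighestWeightDimension.
Variables (F : numFieldType) (k n d : nat).
Variable sigma : 'I_n.+1 -> {ffun 'I_k -> 'I_2}.
Hypothesis sigma_bij : bijective sigma.
Local Notation D := (dhomog n.+1 F d).
Local Notation opE := (opE F sigma).
Local Notation opF := (opF F sigma).
Local Notation opH := (opH F sigma).
Local Notation has_weight := (has_weight sigma).
Local Notation weight := (weight sigma).
Implicit Types (P : D) (u : 'rV[int]_k) (J : seq 'I_k).

(** Restriction to degree d gives endomorphisms of a finite-dimensional space, where dimensions can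
    be compared. *)
Definition dhomog_linder (A : 'M[F]_n.+1) P : D :=
  DHomog (linder_dhomog A (dhomog_is_dhomog P)).

Lemma dhomog_linder_is_linear A : linear (dhomog_linder A).
Proof. by move=> c P Q; apply: val_inj; rewrite /= !linearP. Qed.

HB.instance Definition _ A :=
  GRing.isLinear.Build F D D _ (dhomog_linder A) (dhomog_linder_is_linear A).

Definition endE i : 'End(D) :=
  linfun (dhomog_linder (tens_at sigma i (sl2E F))).
Definition endF i : 'End(D) :=
  linfun (dhomog_linder (tens_at sigma i (sl2F F))).
Definition endH i : 'End(D) :=
  linfun (dhomog_linder (tens_at sigma i (sl2H F))).

Lemma val_endE i P : val (endE i P) = opE i (val P).
Proof. by rewrite lfunE. Qed.

Lemma val_endF i P : val (endF i P) = opF i (val P).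
Proof. by rewrite lfunE. Qed.

Lemma val_endH i P : val (endH i P) = opH i (val P).
Proof. by rewrite lfunE. Qed.

Definition weight_space u : {vspace D} :=
  (\bigcap_i lker (endH i - (u 0 i)%:~R *: \1%VF))%VS.

Lemma memv_weight_space u P :
  P \in weight_space u <-> has_weight u (val P).
Proof.
rewrite memvE; split=> [/subv_bigcapP Pu i|Pu].
  have := Pu i isT; rewrite -memvE memv_ker.
  rewrite add_lfunE opp_lfunE scale_lfunE id_lfunE subr_eq0.
  by move/eqP/(congr1 val); rewrite val_endH.
apply/subv_bigcapP => i _; rewrite -memvE memv_ker.
rewrite add_lfunE opp_lfunE scale_lfunE id_lfunE subr_eq0.
by apply/eqP/val_inj; rewrite val_endH Pu.
Qed.

(** Kernels are added one index at a time so that rank-nullity applies to each new [endF i]. *)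
Definition lowest_weight_space J u : {vspace D} :=
  foldr (fun i U => U :&: lker (endF i))%VS (weight_space u) J.

Let lowest_weight_space_cons i J u : lowest_weight_space (i :: J) u =
  (lowest_weight_space J u :&: lker (endF i))%VS.
Proof. by []. Qed.

Lemma memv_lowest_weight_space J u P :
  P \in lowest_weight_space J u <->
  has_weight u (val P) /\ (forall i, i \in J -> opF i (val P) = 0).
Proof.
elim: J => [|i J IHJ].
  by split=> [/memv_weight_space|[/memv_weight_space]].
rewrite lowest_weight_space_cons memv_cap memv_ker.
split=> [/andP[/IHJ[Pu PJ] /eqP Pi]|[Pu PJ]].
  split=> // j; rewrite inE => /predU1P[->|/PJ//].
  by rewrite -val_endF Pi.
apply/andP; split; last by apply/eqP/val_inj; rewrite val_endF PJ ?mem_head.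
by apply/IHJ; split=> // j jJ; rewrite PJ // inE jJ orbT.
Qed.

(** The bound on [u 0 i] makes the i-th weight of the target negative. There F_i E_i is injective,
    hence onto by dimension, and E_i maps the target into the source. As i is not in J, both
    operators commute with the F_j imposed. *)
Lemma limg_endF J u i : i \notin J -> u 0 i <= 1 ->
  (endF i @: lowest_weight_space J u)%VS =
  lowest_weight_space J (u - delta_mx 0 i *+ 2).
Proof.
move=> iJ ui; set v := u - _; apply/eqP; rewrite eqEsubv; apply/andP; split.
  apply/subvP => _ /memv_imgP[P /memv_lowest_weight_space[Pu PJ] ->].
  apply/memv_lowest_weight_space; rewrite val_endF; split=> [|j jJ].
    exact: has_weight_opF.
  have ji : j != i by apply: contraNneq iJ => <-.
  by rewrite opFF_comm // PJ // linear0.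
set U := lowest_weight_space J v.
have EU P : P \in U -> endE i P \in lowest_weight_space J u.
  move=> /memv_lowest_weight_space[Pv PJ]; apply/memv_lowest_weight_space.
  rewrite val_endE; split=> [|j jJ].
    by have := has_weight_opE sigma_bij i Pv; rewrite /v subrK.
  have ji : j != i by apply: contraNneq iJ => <-.
  by rewrite opFE_comm // PJ // linear0.
have sub : ((endF i \o endE i) @: U <= U)%VS.
  apply/subvP => _ /memv_imgP[P PU ->]; rewrite comp_lfunE.
  move/EU: PU => /memv_lowest_weight_space[Pu PJ].
  apply/memv_lowest_weight_space; rewrite val_endF; split=> [|j jJ].
    exact: has_weight_opF.
  have ji : j != i by apply: contraNneq iJ => <-.
  by rewrite opFF_comm // PJ // linear0.
have dim_eq : \dim ((endF i \o endE i) @: U) = \dim U.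
  apply: limg_dim_eq; apply/eqP; rewrite -subv0; apply/subvP => P.
  rewrite memv_cap memv_ker comp_lfunE.
  move=> /andP[/memv_lowest_weight_space[Pv _]].
  move/eqP/(congr1 val); rewrite val_endF val_endE /= => FE0.
  rewrite memv0; apply/eqP/val_inj.
  apply: (opFE_injective sigma_bij (dhomog_is_dhomog P) Pv _ FE0).
  by rewrite /v mxE [X in _ + X]mxE mulmxnE !mxE !eqxx /=; lia.
have /eqP <- : ((endF i \o endE i) @: U)%VS == U.
  by rewrite eqEdim sub dim_eq leqnn.
apply/subvP => _ /memv_imgP[P PU ->]; rewrite comp_lfunE.
exact/memv_img/EU.
Qed.

(** Rank-nullity for [endF i] on the space for J: the kernel is the space for [i :: J] and
    [limg_endF] gives the image. The bound on u survives the induction because weights only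
    decrease. *)
Lemma dim_lowest_weight_space (C : laurent k int) J u :
  (forall v, (\dim (weight_space v))%:Z = lcoef v C) ->
  uniq J -> (forall i, u 0 i <= 1) ->
  (\dim (lowest_weight_space J u))%:Z =
  lcoef u (\prod_(i <- J) (1 - lvar int i ^+ 2) * C).
Proof.
move=> dimC; elim: J u => [|i J IHJ] u.
  by rewrite big_nil mul1r => _ _; apply: dimC.
move=> /= /andP[iJ uJ] u1; rewrite big_cons -mulrA lcoef_weyl_factor.
have v1 j : (u - delta_mx 0 i *+ 2) 0 j <= 1.
  rewrite mxE [X in _ + X]mxE mulmxnE !mxE eqxx /=.
  by have := u1 j; case: (j == i) => /=; lia.
rewrite -!IHJ // -(limg_endF iJ (u1 i)).
by rewrite -(limg_ker_dim (endF i) (lowest_weight_space J u)) PoszD addrK.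
Qed.

End HighestWeightDimension.

(** * Monomial bases of weight spaces *)

Section WeightSpaceDimension.
Variables (F : numFieldType) (k n d : nat).
Variable sigma : 'I_n.+1 -> {ffun 'I_k -> 'I_2}.
Hypothesis sigma_bij : bijective sigma.
Local Notation D := (dhomog n.+1 F d).

(** A monomial of degree other than d gets the default value 0. *)
Definition dhomogXm (m : 'X_{1..n.+1}) : D := insubd (0 : D) 'X_[m].

Lemma val_dhomogXm m : mdeg m = d -> val (dhomogXm m) = 'X_[m].
Proof. by move=> md; rewrite insubdK // dhomogX; apply/eqP. Qed.

Lemma val_dhomog_sum (I : Type) (r : seq I) (G : I -> D) :
  val (\sum_(i <- r) G i) = \sum_(i <- r) val (G i).
Proof. by rewrite raddf_sum. Qed.

Lemma free_dhomogXm (s : seq 'X_{1..n.+1}) :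
  uniq s -> {in s, forall m, mdeg m = d} -> free (map dhomogXm s).
Proof.
move=> us sd; rewrite -[map _ _]in_tupleE; apply/freeP => c c0 j.
have jP := ltn_ord j; rewrite [X in (_ < X)%N]size_map in jP.
have := congr1 (fun P : D => (val P)@_(nth 0%MM s j)) c0.
rewrite val_dhomog_sum raddf_sum /= mcoeff0 (bigD1 j) //= big1 => [|l lj].
  rewrite (nth_map 0%MM) // val_dhomogXm ?sd ?mem_nth //.
  by rewrite mcoeffZ mcoeffX eqxx mulr1 addr0.
have lP := ltn_ord l; rewrite [X in (_ < X)%N]size_map in lP.
rewrite (nth_map 0%MM) // val_dhomogXm ?sd ?mem_nth //.
by rewrite mcoeffZ mcoeffX nth_uniq // (inj_eq val_inj) (negPf lj) mulr0.
Qed.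

Lemma dim_weight_space (ms : seq 'X_{1..n.+1}) u :
  uniq ms -> (forall m, (m \in ms) = (mdeg m == d)) ->
  \dim (weight_space F d sigma u) = count (fun m => weight sigma m == u) ms.
Proof.
move=> ums memms; pose s := [seq m <- ms | weight sigma m == u].
have sd : {in s, forall m, mdeg m = d}.
  by move=> m; rewrite mem_filter memms => /andP[_ /eqP].
have fr : free (map dhomogXm s) by rewrite free_dhomogXm ?filter_uniq.
suff -> : weight_space F d sigma u = <<map dhomogXm s>>%VS.
  by move/eqP: fr => ->; rewrite size_map size_filter.
apply/eqP; rewrite eqEsubv; apply/andP; split; apply/subvP => P; last first.
  apply/subvP/span_subvP => _ /mapP[m ms_m ->].
  apply/memv_weight_space/(has_weightP sigma_bij) => m'.
  rewrite val_dhomogXm ?sd // mcoeffX; have [<- _|] := eqVneq m m'.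
    by move: ms_m; rewrite mem_filter => /andP[/eqP].
  by rewrite eqxx.
move/memv_weight_space/(has_weightP sigma_bij) => Pu.
have Pd m : (val P)@_m != 0 -> mdeg m = d.
  move=> Pm; move/dhomogP: (dhomog_is_dhomog P) => -> //.
  by rewrite mcoeff_msupp.
have -> : P = \sum_(m <- msupp (val P)) (val P)@_m *: dhomogXm m.
  apply: val_inj; rewrite val_dhomog_sum [LHS]mpolyE big_seq [RHS]big_seq.
  apply: eq_bigr => m; rewrite mcoeff_msupp => /Pd md.
  by rewrite -[in LHS](val_dhomogXm md).
rewrite big_seq; apply: memv_suml => m; rewrite mcoeff_msupp => Pm.
apply/memvZ/memv_span/map_f; rewrite mem_filter memms Pu // Pd //.
by rewrite !eqxx.
Qed.

End WeightSpaceDimension.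

(** * Expansion of the product of geometric series *)

(** Weak compositions: parts equal to 0 are allowed. *)
Fixpoint compositions (s d : nat) : seq (seq nat) :=
  if s is s'.+1 then
    [seq j :: t | j <- iota 0 d.+1, t <- compositions s' (d - j)]
  else if d == 0%N then [:: [::]] else [::].

Lemma compositionsS s d : compositions s.+1 d =
  [seq j :: t | j <- iota 0 d.+1, t <- compositions s (d - j)].
Proof. by []. Qed.

Lemma mem_compositions s d t :
  (t \in compositions s d) = (size t == s) && (sumn t == d).
Proof.
elim: s d t => [|s IHs] d t.
  rewrite /=; case: t => [|x t]; case: eqP => [->|]; rewrite ?inE //=.
  by move/eqP/negPf; rewrite eq_sym.
rewrite compositionsS; apply/allpairsPdep/andP => [[j [t' [jd]]]|].
  rewrite IHs => /andP[/eqP <- /eqP tE] -> /=; rewrite eqxx; split=> //.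
  by move: jd; rewrite mem_iota tE; lia.
case: t => [[]|j t [/eqP[st] /eqP tE]] //; exists j, t.
have {}tE : (j + sumn t)%N = d by [].
by rewrite mem_iota IHs st eqxx; split=> //; lia.
Qed.

Lemma uniq_compositions s d : uniq (compositions s d).
Proof.
elim: s d => [|s IHs] d; first by rewrite /=; case: eqP.
apply: allpairs_uniq_dep => [|//|]; first exact: iota_uniq.
by move=> [j t] [j' t'] _ _ /= [-> ->].
Qed.

(** A term of the product chooses a power of q in each factor; the recursion of [compositions]
    mirrors the Cauchy product. *)
Lemma big_ps_geom (A : comNzRingType) (I : Type) (r : seq I) (M : I -> A) d :
  (\big[@ps_mul A/ps_const 1]_(i <- r) ps_geom (M i)) d =
  \sum_(t <- compositions (size r) d) \prod_(x <- zip r t) M x.1 ^+ x.2.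
Proof.
elim: r d => [|i r IHr] d.
  rewrite big_nil /ps_const /=; case: eqP => _; last by rewrite big_nil.
  by rewrite big_seq1 big_nil.
rewrite big_cons /ps_mul [size _]/= compositionsS big_allpairs_dep.
rewrite -[iota 0 d.+1]/(index_iota 0 d.+1) big_mkord; apply: eq_bigr => j _.
by rewrite IHr mulr_sumr; apply: eq_bigr => t _; rewrite big_cons.
Qed.

(** Turns a list of exponents into a function of the factor, so that products can be reindexed by
    the variables. *)
Lemma zip_nth_index (I : eqType) (r : seq I) (t : seq nat) :
  uniq r -> size t = size r ->
  zip r t = [seq (x, nth 0%N t (index x r)) | x <- r].
Proof.
case: r => [|x0 r0]; first by case: t.
set r := x0 :: r0 => ur st; apply: (@eq_from_nth _ (x0, 0%N)).
  by rewrite size_zip size_map st minnn.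
move=> i; rewrite size_zip st minnn => ir.
by rewrite nth_zip // (nth_map x0) // index_uniq.
Qed.

Section Expansion.
Variables (k n : nat) (sigma : 'I_n -> {ffun 'I_k -> 'I_2}).
Hypothesis sigma_bij : bijective sigma.
Local Notation L := (laurent k int).

Lemma lmonom_prod (I : Type) (r : seq I) (P : pred I) (f : I -> 'rV[int]_k) :
  \prod_(i <- r | P i) (lmonom (f i) 1 : L) =
  lmonom (\sum_(i <- r | P i) f i) 1.
Proof.
apply/esym/(big_morph (fun v => lmonom v (1 : int) : L)) => // u v.
by rewrite lmonomM mulr1.
Qed.

Lemma lmonomV (v : 'rV[int]_k) : (lmonom v (1 : int) : L)^-1 = lmonom (- v) 1.
Proof.
have U : (lmonom v 1 : L) \is a GRing.unit.
  apply/unitrP; exists (lmonom (- v) 1).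
  by rewrite !lmonomM mulr1 addNr addrN.
by apply: (mulrI U); rewrite divrr // lmonomM addrN mulr1.
Qed.

(** The subset S whose factor in the product corresponds to the variable a: digit 0 has weight +1,
    so that index goes to the numerator. *)
Definition support0 a : {set 'I_k} := [set i | sigma a i == 0].

Lemma support0_bij : bijective support0.
Proof.
have [tau sK tK] := sigma_bij.
exists (fun S : {set 'I_k} => tau [ffun i => if i \in S then 0 else 1]).
  move=> a; rewrite -[RHS]sK; congr tau; apply/ffunP => i; rewrite ffunE inE.
  by case: (sigma a i) => [[|[|[]]]] // ?; apply: val_inj.
by move=> S; apply/setP => i; rewrite inE tK ffunE; case: ifP.
Qed.

Lemma weight_monomialE a :
  weight_monomial (support0 a) = lmonom (\row_i (-1) ^+ sigma a i) 1.
Proof.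
rewrite /weight_monomial !lmonom_prod lmonomV lmonomM mulr1; congr lmonom.
apply/rowP => i; rewrite !mxE !summxE.
have sumE (S : {set 'I_k}) :
    \sum_(j in S) (delta_mx 0 j : 'rV[int]_k) 0 i = (i \in S)%:R.
  have [iS|iS] := boolP (i \in S).
    rewrite (bigD1 i) //= mxE !eqxx big1 ?addr0 // => j /andP[_ ji].
    by rewrite mxE eqxx eq_sym (negPf ji).
  rewrite big1 // => j jS; rewrite mxE eqxx /=; case: eqP jS => // <-.
  by rewrite (negPf iS).
rewrite !sumE !inE; case: (sigma a i) => [[|[|[]]]] //.
Qed.

Lemma prod_weight_monomial (m : 'X_{1..n}) :
  \prod_a weight_monomial (support0 a) ^+ m a = lmonom (weight sigma m) 1.
Proof.
under eq_bigr do rewrite weight_monomialE lmonomX.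
rewrite lmonom_prod; congr lmonom; apply/rowP => i; rewrite summxE mxE.
by apply: eq_bigr => a _; rewrite mulmxnE mxE.
Qed.

Lemma geometric_expansion d : exists ms : seq 'X_{1..n},
  [/\ uniq ms, forall m, (m \in ms) = (mdeg m == d) &
  (\big[@ps_mul L/ps_const 1]_(S : {set 'I_k}) ps_geom (weight_monomial S)) d =
  \sum_(m <- ms) lmonom (weight sigma m) 1].
Proof.
have [tau sK tK] := support0_bij.
set r := index_enum _; have ur : uniq r by apply: index_enum_uniq.
have memr S : S \in r by apply: mem_index_enum.
(* The exponent chosen for the factor S becomes the exponent of the variable whose [support0] is
   S. *)
pose mono t := [multinom nth 0%N t (index (support0 a) r) | a < n].
have monoE t a : mono t a = nth 0%N t (index (support0 a) r) by rewrite mnmE.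
have nthE t S : nth 0%N t (index S r) = mono t (tau S) by rewrite monoE tK.
have sumE t : size t = size r -> sumn t = mdeg (mono t).
  move=> st; rewrite -[in LHS](@unzip2_zip _ _ r t) ?st //.
  rewrite zip_nth_index // sumnE !big_map mdegE.
  rewrite (reindex support0) /=; last exact/onW_bij/support0_bij.
  by apply: eq_bigr => a _; rewrite monoE.
exists (map mono (compositions (size r) d)); split.
- rewrite map_inj_in_uniq ?uniq_compositions // => t t'.
  rewrite !mem_compositions => /andP[/eqP st _] /andP[/eqP st' _] eq_m.
  apply: (@eq_from_nth _ 0%N) => [|i]; rewrite st ?st' // => ir.
  by rewrite -(index_uniq set0 ir ur) !nthE eq_m.
- move=> m; apply/mapP/eqP => [[t]|md].
    by rewrite mem_compositions => /andP[/eqP st /eqP <-] ->; rewrite sumE.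
  have mK : mono [seq m (tau x) | x <- r] = m.
    apply/mnmP => a; rewrite monoE (nth_map set0) ?index_mem ?memr //.
    by rewrite nth_index ?memr // sK.
  exists [seq m (tau x) | x <- r] => //.
  by rewrite mem_compositions size_map eqxx sumE ?size_map // mK md eqxx.
rewrite big_ps_geom big_map big_seq [RHS]big_seq.
apply: eq_bigr => t; rewrite mem_compositions => /andP[/eqP st _].
rewrite zip_nth_index // big_map (reindex support0) /=; last first.
  exact/onW_bij/support0_bij.
by rewrite -prod_weight_monomial; apply: eq_bigr => a _; rewrite monoE.
Qed.

Lemma weight_expansionE d : exists ms : seq 'X_{1..n},
  [/\ uniq ms, forall m, (m \in ms) = (mdeg m == d) &
  weight_expansion k d =
  \prod_(i <- enum 'I_k) (1 - lvar int i ^+ 2) *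
  \sum_(m <- ms) lmonom (weight sigma m) 1].
Proof.
have [ms [ums memms msE]] := geometric_expansion d.
exists ms; split=> //; rewrite -msE /weight_expansion {1}/ps_mul.
(* The numerator is constant in q, so only the term j = 0 of the Cauchy product survives. *)
rewrite big_ord_recl /= subn0 [X in _ + X]big1 ?addr0 => [|j _]; last first.
  by rewrite /ps_const mul0r.
by rewrite big_enum.
Qed.

Lemma lcoef_sum_lmonom (ms : seq 'X_{1..n}) u :
  lcoef u (\sum_(m <- ms) lmonom (weight sigma m) 1 : L) =
  (count (fun m => weight sigma m == u) ms)%:Z.
Proof.
rewrite lcoef_sum; elim: ms => [|m ms IHms]; first by rewrite big_nil.
by rewrite big_cons IHms lcoef_monom /= PoszD; case: eqP.
Qed.

End Expansion.

(** * Binary digits and the iterated tensor product *)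

(** Follows the recursion of [tensmx_iter], splitting indices by the same [mxtens_unindex] as
    [tensmx]. *)
Fixpoint digit (m : nat) : 'I_(2 ^ m) -> 'I_m -> 'I_2 :=
  if m is m'.+1 then fun a i =>
    let a' := mxtens_unindex (cast_ord (expnS 2 m') a) in
    if unlift ord0 i is Some j then digit a'.2 j else a'.1
  else fun _ _ => 0.

Lemma digitS m (a : 'I_(2 ^ m.+1)) i :
  digit a i = let a' := mxtens_unindex (cast_ord (expnS 2 m) a) in
              if unlift ord0 i is Some j then digit a'.2 j else a'.1.
Proof. by []. Qed.

Definition digits (m : nat) (a : 'I_(2 ^ m)) : {ffun 'I_m -> 'I_2} :=
  [ffun i => digit a i].

Lemma digit_inj m (a b : 'I_(2 ^ m)) : digit a =1 digit b -> a = b.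
Proof.
elim: m a b => [a b _|m IHm a b eq_ab]; first by rewrite (ord1 a) (ord1 b).
apply/(@cast_ord_inj _ _ (expnS 2 m))/(can_inj (@mxtens_unindexK 2 (2 ^ m))).
set x := mxtens_unindex _; set y := mxtens_unindex _.
have eq1 : x.1 = y.1 by have := eq_ab ord0; rewrite !digitS unlift_none.
have /IHm eq2 : digit x.2 =1 digit y.2.
  by move=> j; have := eq_ab (lift ord0 j); rewrite !digitS liftK.
by rewrite [x]surjective_pairing [y]surjective_pairing eq1 eq2.
Qed.

Lemma digits_bij m : bijective (@digits m).
Proof.
apply: inj_card_bij => [a b /ffunP eq_ab|].
  by apply: digit_inj => i; have := eq_ab i; rewrite !ffunE.
by rewrite card_ffun !card_ord.
Qed.

Lemma tensmx_iterE (R : realType) m (A : 'I_m -> 'M[R[i]]_2) :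
  tensmx_iter A = tens (@digits m) A.
Proof.
apply/matrixP => a b; rewrite mxE; under eq_bigr do rewrite !ffunE.
elim: m A a b => [|m IHm] A a b.
  by rewrite big_ord0 mxE (ord1 a) (ord1 b).
rewrite /= castmxE !esymK mxE IHm big_ord_recl /= unlift_none; congr (_ * _).
by apply: eq_bigr => i _; rewrite liftK.
Qed.

(* The number of variables is a parameter, not [2 ^ k]: [dhomog n F d] is a
   [vectType] only when [n] is syntactically a successor. *)
Lemma dim_tensor_invariants (F : numFieldType) (k n d : nat)
    (sigma : 'I_n -> {ffun 'I_k -> 'I_2}) (S : {mpoly F[n]} -> Prop) :
  bijective sigma ->
  (forall p, S p <-> p \is d.-homog /\
     forall A : 'I_k -> 'M[F]_2, (forall i, \det (A i) = 1) ->
       linsubst (tens sigma A) p = p) ->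
  (dimension S)%:Z = constant_term (weight_expansion k d).
Proof.
case: n sigma S => [|n] sigma S sbij SP.
  (* There is at least one digit vector, so n = 0 is impossible. *)
  by case: sbij => tau _ _; case: (tau [ffun=> 0]).
have [ms [ums memms ->]] := weight_expansionE sbij d.
rewrite /constant_term.
(* The constant term is the coefficient at u = 0, with all F_i imposed; by [killed_opEP] this space
   consists of the invariants. *)
rewrite -(dim_lowest_weight_space (F := F) (d := d) sbij); first last.
- by move=> i; rewrite mxE.
- exact: enum_uniq.
- by move=> v; rewrite (dim_weight_space F sbij _ ums memms) lcoef_sum_lmonom.
congr Posz; set U := lowest_weight_space _ _ _ _ _.
have memU (P : dhomog n.+1 F d) : P \in U <-> S (val P).
  have hP := dhomog_is_dhomog P.
  rewrite memv_lowest_weight_space SP; split=> [[P0 PF]|[_]].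
    split=> //; apply/tens_invariantP => //; apply/(killed_opEP sbij hP).
    by split=> // i; rewrite PF // mem_enum.
  move/(tens_invariantP sbij)/(killed_opEP sbij hP) => [P0 PF].
  by split=> // i _.
have valsum (c : 'I_(\dim U) -> F) :
    \sum_i c i *: val (vbasis U)`_i =
    val (\sum_i c i *: (vbasis U)`_i : dhomog n.+1 F d).
  by rewrite raddf_sum; apply: eq_bigr.
apply: (dimension_basis (e := fun i => val (vbasis U)`_i)).
split=> [i|c|p Sp].
- by apply/memU/vbasis_mem; rewrite mem_nth // size_tuple.
- rewrite valsum -(raddf0 (val : dhomog n.+1 F d -> _)) => /val_inj.
  by move/freeP: (basis_free (vbasisP U)) => fr; apply: fr.
have /SP[hp _] := Sp; have PU : DHomog hp \in U by apply/memU.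
exists (fun i => coord (vbasis U) i (DHomog hp)).
by rewrite valsum -coord_vbasis.
Qed.

Theorem theorem2p1 (R : realType) (k : nat) (hk : (1 <= k)%N) :
  forall d : nat,
    (hilbert_series R k d)%:Z = constant_term (weight_expansion k d).
Proof.
move=> d; apply: (dim_tensor_invariants (@digits_bij k)) => p.
by split=> -[hp inv]; (split; first exact: hp) => A detA;
  [rewrite -tensmx_iterE | rewrite /mpoly_act tensmx_iterE]; apply: inv.
Qed.
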